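(* Let $k\ge1$ and $a\ge1$ be integers and let $x>0$, $y\ge0$ be real numbers. Then $$\operatorname{vol}\mathcal F_{\mathrm{MCar}^{(k)}_{a+2}}(kx,\underbrace{y,\ldots,y}_{a},-(kx+ay))=\mathrm{Cat}(a,ka-1)\cdot(kx)^{ka-1}(kx+ay)^{a-1}.$$
   Context: $\mathrm{MCar}^{(k)}_{a+2}$ is the directed multigraph on $\{0,1,\ldots,a+1\}$ with edges $(i,i+1)$ for $1\le i\le a$, $(i,a+1)$ for $1\le i\le a-1$, and $k$ distinct parallel edges $(0,i)$ for each $1\le i\le a$. The net flow vector is indexed by vertices $0,1,\ldots,a+1$: vertex $0$ gets $kx$, vertices $1,\ldots,a$ get $y$, vertex $a+1$ gets $-(kx+ay)$. $\mathcal F_G(\mathbf a)$ is the set of nonnegative edge flows (one coordinate per edge) with outflow minus inflow at each non-final vertex $j$ equal to its net flow $a_j$. The normalized volume of a $d$-dimensional polytope is $d!$ times its relative volume with respect to the integer lattice. $\mathrm{Cat}(a,b)=\frac1{a+b}\binom{a+b}{a}$. *)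

(* Defs.v *)
From HB Require Import structures.
From mathcomp Require Import all_boot all_order all_algebra.
From mathcomp Require Import all_classical all_reals all_analysis.

Set Implicit Arguments.
Unset Strict Implicit.
Unset Printing Implicit Defensive.

Import Order.TTheory GRing.Theory Num.Theory.
Local Open Scope classical_set_scope.
Local Open Scope ring_scope.

Section volume.
Variable R : realType.

(* Lebesgue measure on R^d, as an iterated product measure: the successor case
   is the formula [product_measure1], i.e. the integral of the measures of the
   sections. *)
Fixpoint lebesgue_tuple (d : nat) : set (d.-tuple R) -> \bar R :=
  match d with
  | 0 => fun A => (\1_A [tuple])%:E
  | d'.+1 => fun A =>
      (\int[lebesgue_measure]_x
         lebesgue_tuple [set t : d'.-tuple R | A [tuple of x :: t]])%E
  end.

Variable E : finType.

Definition affine_hull (P : set {ffun E -> R}) : set {ffun E -> R} :=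
  [set f | exists n (p : 'I_n -> {ffun E -> R}) (c : 'I_n -> R),
     [/\ forall i, P (p i), \sum_i c i = 1
       & forall e, f e = \sum_i c i * p i e]].

Definition affine_param (d : nat) (v : {ffun E -> R})
    (b : 'I_d -> {ffun E -> int}) (t : d.-tuple R) : {ffun E -> R} :=
  [ffun e => v e + \sum_i tnth t i * (b i e)%:~R].

(* The affine hull of P is v + V with V a linear subspace of dimension d, and b
   is both an R-basis of V and a Z-basis of the lattice of integer points of V.
   In particular d is the dimension of P. *)
Definition lattice_frame (P : set {ffun E -> R}) (d : nat)
    (v : {ffun E -> R}) (b : 'I_d -> {ffun E -> int}) : Prop :=
  [/\ affine_hull P = range (affine_param v b),
      injective (affine_param v b)
    & forall w : {ffun E -> int},
        (exists t : d.-tuple R,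
           forall e, (w e)%:~R = \sum_i tnth t i * (b i e)%:~R) ->
        exists c : 'I_d -> int, forall e, w e = \sum_i c i * b i e].

(* [get] picks the value computed in some lattice frame; the value does not
   depend on the frame since two frames differ by a translation and an element
   of GL_d(Z). *)
Definition normalized_volume (P : set {ffun E -> R}) : \bar R :=
  [get V | exists d (v : {ffun E -> R}) (b : 'I_d -> {ffun E -> int}),
     lattice_frame P v b /\
     V = (d`!%:R%:E * lebesgue_tuple (affine_param v b @^-1` P))%E].

End volume.

Record multigraph (n : nat) := Multigraph {
  edge : finType;
  source : edge -> 'I_n;
  target : edge -> 'I_n
}.

Definition flow_polytope (R : realType) (n : nat) (G : multigraph n.+1)
    (a : 'I_n.+1 -> R) : set {ffun edge G -> R} :=
  [set f | (forall e, 0 <= f e) /\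
     forall j : 'I_n.+1, j != ord_max ->
       \sum_(e | source e == j) f e - \sum_(e | target e == j) f e = a j].

(* The three summands index, in order (with i starting at 0), the edges
   (i+1, i+2) for i < a, the edges (i+1, a+1) for i < a-1, and the k parallel
   edges (0, i+1) for each i < a. *)
Definition MCar (k a : nat) : multigraph a.+2 :=
  @Multigraph a.+2 ('I_a + 'I_a.-1 + 'I_k * 'I_a)%type
    (fun e => match e with
              | inl (inl i) => inord i.+1
              | inl (inr i) => inord i.+1
              | inr _ => ord0
              end)
    (fun e => match e with
              | inl (inl i) => inord i.+2
              | inl (inr _) => ord_max
              | inr (_, i) => inord i.+1
              end).

Definition MCar_netflow (R : realType) (k a : nat) (x y : R) (j : 'I_a.+2) : R :=
  if j == ord0 then k%:R * x
  else if j == ord_max then - (k%:R * x + a%:R * y)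
  else y.

Definition Cat (R : realType) (a b : nat) : R :=
  'C(a + b, a)%:R / (a + b)%:R.

(* Main.v *)
(** The normalized volume does not depend on the lattice frame: two frames differ
    by a translation and an integer matrix of determinant [1] or [-1], and iterated
    integrals are invariant under these by Tonelli's theorem and an LUP
    decomposition. In the frame whose coordinates are all edge flows except those
    of the chain edges [(i, i+1)] and of one edge from [0] to [a], the volume is
    integrated vertex by vertex. Let [X = kx], let [r] be the source flow not yet
    distributed and [s] the flow currently leaving a vertex, and suppose that [j]
    of its incoming source edges and the edge to the sink are still to be
    integrated, with [n] further vertices behind it. With [q = kn + j - 1] and
    [T = s + n y + r], the remaining volume is
    [T^(n-1) / n! * (s r^q / q! + j r^(q+1) / (q+1)!)]:
    integrating over a source edge leaves [T] unchanged, and integrating over the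
    edge to the sink amounts to
    [d/ds (s (s + n y + r)^(n-1)) = (n s + n y + r) (s + n y + r)^(n-2)].
    At the start [n = a - 1], [j = k], [s = y] and [r = X]. *)

Require Import Defs.
From mathcomp Require Import all_boot all_order all_algebra.
From mathcomp Require Import all_classical all_reals all_analysis.
From mathcomp Require Import perm measurable_realfun ring lra zify.

Set Implicit Arguments.
Unset Strict Implicit.
Unset Printing Implicit Defensive.

Import Order.TTheory GRing.Theory Num.Theory.
Import numFieldNormedType.Exports.
Local Open Scope classical_set_scope.
Local Open Scope ring_scope.

(** * Affine substitution and iterated integrals *)

Section affine_change.
Variable R : realType.
Notation mu := (@lebesgue_measure R).

Lemma measurable_affine (c t : R) :
  measurable_fun [set: R] (fun x : R => c * x + t).
Proof.
by apply: measurable_funD => //; apply: measurable_funM.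
Qed.

(** The pushforward of Lebesgue measure under [c * x + t], scaled by [|c|], gives each interval []a,
    b]] its length, so it is Lebesgue measure by uniqueness. *)
Lemma lebesgue_measure_affine (c t : R) (A : set R) : c != 0 -> measurable A ->
  mu A = (`|c|%:E * mu ((fun x => c * x + t)%R @^-1` A))%E.
Proof.
move=> c0 mA.
pose phi : R -> measurableTypeR R := fun x => c * x + t.
have mphi : measurable_fun [set: R] phi by exact: measurable_affine.
pose pf := measure_function_pushforward__canonical__measure_function_Measure mu mphi.
have c1 : 0 <= `|c| by [].
rewrite -[RHS]/(mscale (NngNum c1) pf A).
apply: (@lebesgue_measure_unique R (mscale (NngNum c1) pf)) => // _ [[a b]] _ <-.
rewrite /= /mscale /= /pushforward /phi.
have [cpos|cneg|c00] := ltgtP 0 c; last by rewrite -c00 eqxx in c0.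
- have -> : (fun x => c * x + t) @^-1` `]a, b] = `](a - t) / c, (b - t) / c]%classic.
    apply/seteqP; split => x /=; rewrite !in_itv /=;
    by rewrite ltr_pdivrMr // ler_pdivlMr // ltrBlDr lerBrDr [x * c]mulrC.
  rewrite !lebesgue_measure_itv /= !lte_fin ltr_pM2r ?invr_gt0 // ltrD2r.
  case: ifP => _; last by rewrite mule0.
  by rewrite -!EFinB -EFinM gtr0_norm //; congr (_%:E); field.
- have -> : (fun x => c * x + t) @^-1` `]a, b] = `[(b - t) / c, (a - t) / c[%classic.
    apply/seteqP; split => x /=; rewrite !in_itv /= andbC;
    by rewrite ltr_ndivlMr // ler_ndivrMr // ltrBlDr lerBrDr [x * c]mulrC.
  rewrite !lebesgue_measure_itv /= !lte_fin ltr_nM2r ?invr_lt0 // ltrD2r.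
  case: ifP => _; last by rewrite mule0.
  by rewrite -!EFinB -EFinM ltr0_norm //; congr (_%:E); field.
Qed.

Lemma ge0_integral_affine (c t : R) (f : R -> \bar R) : c != 0 ->
  measurable_fun [set: R] f -> (forall x, 0 <= f x)%E ->
  (\int[mu]_x f x = `|c|%:E * \int[mu]_x f (c * x + t)%R)%E.
Proof.
move=> c0 mf f0.
pose phi : R -> measurableTypeR R := fun x => c * x + t.
have mphi : measurable_fun [set: R] phi by exact: measurable_affine.
pose pf := measure_function_pushforward__canonical__measure_function_Measure mu mphi.
have c1 : 0 <= `|c| by [].
rewrite (eq_measure_integral (mscale (NngNum c1) pf)).
  by rewrite ge0_integral_mscale // ge0_integral_pushforward.
by move=> A mA _; rewrite [LHS](lebesgue_measure_affine t c0 mA).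
Qed.

End affine_change.

Lemma map_enum_ordS (T : Type) n (h : 'I_n.+1 -> T) :
  [seq h i | i <- enum 'I_n.+1] = h ord0 :: [seq h (lift ord0 i) | i <- enum 'I_n].
Proof. by rewrite enum_ordSl map_cons -map_comp. Qed.

Section iterated_integral.
Variables (R : realType) (E : finType).
Notation V := {ffun E -> R}.
Notation mu := (@lebesgue_measure R).

Definition axpy (v : V) (x : R) (b : V) : V := [ffun e => v e + x * b e].

Lemma axpyC v x b x' b' : axpy (axpy v x b) x' b' = axpy (axpy v x' b') x b.
Proof. by apply/ffunP => e; rewrite !ffunE addrAC. Qed.

Lemma axpyA v x b x' : axpy (axpy v x b) x' b = axpy v (x + x') b.
Proof. by apply/ffunP => e; rewrite !ffunE mulrDl addrA. Qed.

Definition mfam d (T : measurableType d) (p : T -> V) :=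
  forall e, measurable_fun [set: T] (fun t => p t e).

Lemma mfam_axpy d (T : measurableType d) (p : T -> V) (g : T -> R) b :
  mfam p -> measurable_fun [set: T] g -> mfam (fun t => axpy (p t) (g t) b).
Proof.
move=> mp mg e; under eq_fun do rewrite ffunE.
by apply: measurable_funD => //; apply: measurable_funM.
Qed.

(** Measurability is tested on parametrised families of points that are measurable in each
    coordinate. This fixes no sigma-algebra on [V] and is preserved when a direction is integrated
    out. *)
Definition mfam_measurable (f : V -> \bar R) :=
  forall d (T : measurableType d) (p : T -> V), mfam p ->
    measurable_fun [set: T] (fun t => f (p t)).

Fixpoint iter_int (f : V -> \bar R) (s : seq V) (v : V) : \bar R :=
  if s is b :: s' then (\int[mu]_x iter_int f s' (axpy v x b))%E else f v.

Variable f : V -> \bar R.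
Hypothesis f0 : forall v, (0 <= f v)%E.
Hypothesis mf : mfam_measurable f.

Lemma iter_int_ge0 s v : (0 <= iter_int f s v)%E.
Proof. by elim: s v => [|b s IH] v //=; apply: integral_ge0. Qed.

(** The new integration variable is added to the parameter space; by Tonelli, section integrals of a
    nonnegative measurable function are measurable. *)
Lemma measurable_iter_int s : mfam_measurable (iter_int f s).
Proof.
elim: s => [|b s IH] d T p mp /=; first exact: mf.
pose F (z : T * R) := iter_int f s (axpy (p z.1) z.2 b).
have := @measurable_fun_fubini_tonelli_F _ _ T (measurableTypeR R) R mu F.
apply; last by move=> z; exact: iter_int_ge0.
have mp1 : mfam (fun z : T * measurableTypeR R => p z.1).
  by move=> e; exact: measurableT_comp (mp e) measurable_fst.
exact: (IH _ _ _ (mfam_axpy b mp1 measurable_snd)).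
Qed.

Lemma measurable_iter_int_axpy s v b :
  measurable_fun [set: R] (fun x => iter_int f s (axpy v x b)).
Proof. by apply: measurable_iter_int; apply: mfam_axpy => // e. Qed.

Lemma iter_int_swap b1 b2 s v :
  iter_int f (b1 :: b2 :: s) v = iter_int f (b2 :: b1 :: s) v.
Proof.
rewrite /=; pose F (z : R * R) := iter_int f s (axpy (axpy v z.1 b1) z.2 b2).
rewrite (@fubini_tonelli _ _ (measurableTypeR R) (measurableTypeR R) R mu mu F).
- by apply: eq_integral => y _; apply: eq_integral => x _; rewrite /F /= axpyC.
- have mc : mfam (fun z : measurableTypeR R * measurableTypeR R => v) by move=> e.
  exact: (measurable_iter_int _ (mfam_axpy _ (mfam_axpy _ mc measurable_fst) measurable_snd)).
- by move=> z; exact: iter_int_ge0.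
Qed.

Lemma iter_int_perm s1 s2 v : perm_eq s1 s2 -> iter_int f s1 v = iter_int f s2 v.
Proof.
have cons_mid b t1 t2 u :
    iter_int f (t1 ++ b :: t2) u = iter_int f (b :: t1 ++ t2) u.
  elim: t1 u => [//|c t1 IH] u.
  rewrite [RHS]iter_int_swap /=; apply: eq_integral => x _; exact: IH.
(* It suffices to exchange the two leading blocks of a sequence; [cons_mid] moves one direction
   across a block at a time. *)
move=> s12; apply: (catCA_perm_subst _ s12 (F := fun s => iter_int f s v)).
move=> t1 t2 t3; elim: t1 v => [//|c t1 IH] v.
rewrite cons_mid /=; apply: eq_integral => x _; exact: IH.
Qed.

(** Once [b] is moved to the front, this is translation invariance in one variable. *)
Lemma iter_int_translate s v b c : b \in s ->
  iter_int f s (axpy v c b) = iter_int f s v.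
Proof.
move=> bs; rewrite !(iter_int_perm _ (perm_to_rem bs)) /=.
rewrite [RHS](@ge0_integral_affine _ 1 c) ?oner_neq0 //.
- rewrite normr1 mul1e; apply: eq_integral => x _.
  by rewrite axpyA mul1r addrC.
- exact: measurable_iter_int_axpy.
- by move=> x; exact: iter_int_ge0.
Qed.

(** At parameter [x] the change of direction displaces the base point by [x * c] along [b'], which
    the inner integral over [b'] absorbs. *)
Lemma iter_int_transvect s v b c b' : b' \in s ->
  iter_int f (axpy b c b' :: s) v = iter_int f (b :: s) v.
Proof.
move=> b's /=; apply: eq_integral => x _.
rewrite -[RHS](iter_int_translate _ (x * c) b's); congr iter_int.
by apply/ffunP => e; rewrite !ffunE mulrDr mulrA addrA.
Qed.

Lemma iter_int_scale s v b (c : R) : c != 0 ->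
  (iter_int f (b :: s) v = `|c|%:E * iter_int f ([ffun e => (c * b e)%R] :: s) v)%E.
Proof.
move=> c0 /=; rewrite (@ge0_integral_affine _ c 0) //.
- congr (_ * _)%E; apply: eq_integral => x _; congr iter_int.
  by apply/ffunP => e; rewrite !ffunE addr0; congr (_ + _); ring.
- exact: measurable_iter_int_axpy.
- by move=> x; exact: iter_int_ge0.
Qed.


Lemma iter_int_head (I : eqType) (r : seq I) (g : I -> R) (b' : I -> V) (s : seq V) (v b : V) :
  {in r, forall i, b' i \in s} ->
  iter_int f ([ffun e => b e + \sum_(i <- r) g i * b' i e] :: s) v =
  iter_int f (b :: s) v.
Proof.
elim: r => [|i r IH] rs.
  by congr (iter_int f (_ :: _) _); apply/ffunP => e; rewrite ffunE big_nil addr0.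
rewrite -IH => [|j jr]; last by rewrite rs // inE jr orbT.
rewrite -[RHS](iter_int_transvect _ _ (g i) (rs i (mem_head _ _))).
congr (iter_int f (_ :: _) _); apply/ffunP => e.
by rewrite !ffunE big_cons addrCA [RHS]addrC.
Qed.

Definition comb n (A : 'M[R]_n) (b : 'I_n -> V) (i : 'I_n) : V :=
  [ffun e => \sum_j A i j * b j e].

Lemma comb_mulmx n (A B : 'M[R]_n) b : comb A (comb B b) = comb (A *m B) b.
Proof.
apply/funext => i; apply/ffunP => e; rewrite !ffunE.
under eq_bigr do rewrite ffunE mulr_sumr.
rewrite exchange_big; apply: eq_bigr => j _.
by rewrite mxE mulr_suml; apply: eq_bigr => l _; rewrite mulrA.
Qed.

Lemma perm_enum_inj n (h : 'I_n -> 'I_n) : injective h ->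
  perm_eq [seq h i | i <- enum 'I_n] (enum 'I_n).
Proof.
move=> hI; apply: uniq_perm => [||i].
- by rewrite map_inj_uniq // enum_uniq.
- exact: enum_uniq.
rewrite mem_enum; apply/mapP; exists (invF hI i); rewrite ?mem_enum //.
by rewrite f_invF.
Qed.

Lemma iter_int_reindex n (h : 'I_n -> 'I_n) (b : 'I_n -> V) v : injective h ->
  iter_int f [seq b (h i) | i <- enum 'I_n] v = iter_int f [seq b i | i <- enum 'I_n] v.
Proof.
move=> hI; apply: iter_int_perm; rewrite (map_comp b h).
exact/perm_map/perm_enum_inj.
Qed.

(** The first new direction is [U 0 0] times the old one plus a combination of directions integrated
    further inside. Scaling yields the factor, transvections absorb the combination, and the
    remaining minor is handled by induction. *)
Lemma iter_int_upper n (U : 'M[R]_n) (b : 'I_n -> V) v :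
  (forall i j : 'I_n, (j < i)%N -> U i j = 0) -> (forall i, U i i != 0) ->
  (iter_int f [seq b i | i <- enum 'I_n] v =
   (\prod_i `|U i i|)%:E * iter_int f [seq comb U b i | i <- enum 'I_n] v)%E.
Proof.
elim: n U b v => [|n IH] U b v Uup Udiag.
  by rewrite enum_ord0 /= big_ord0 mul1e.
pose b' i := b (lift ord0 i).
pose U' := \matrix_(i, j) U (lift ord0 i) (lift ord0 j).
have combE i : comb U b (lift ord0 i) = comb U' b' i.
  apply/ffunP => e; rewrite !ffunE big_ord_recl Uup // mul0r add0r.
  by apply: eq_bigr => j _; rewrite mxE.
rewrite !map_enum_ordS.
rewrite (iter_int_scale _ _ _ (Udiag ord0)).
rewrite -[in LHS](iter_int_head (r := enum 'I_n) (fun j => U ord0 (lift ord0 j)) (b' := b'));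
  last by move=> j _; apply/mapP; exists j; rewrite ?mem_enum.
have -> : [ffun e => [ffun e0 => U ord0 ord0 * b ord0 e0] e +
          \sum_(i <- enum 'I_n) U ord0 (lift ord0 i) * b' i e] = comb U b ord0.
  by apply/ffunP => e; rewrite !ffunE big_ord_recl big_enum.
rewrite big_ord_recl EFinM -muleA; congr (_ * _)%E => /=.
under eq_integral => x _.
  rewrite (IH U'); last 2 first.
  - by move=> i j ji; rewrite mxE Uup // lift0 ltnS.
  - by move=> i; rewrite mxE.
  under eq_bigr do rewrite mxE.
  over.
rewrite ge0_integralZl //.
- congr (_ * _)%E; apply: eq_integral => x _; congr iter_int.
  by apply: eq_map => i; rewrite /= combE.
- exact: measurable_iter_int_axpy.
- by move=> x _; exact: iter_int_ge0.
- by rewrite lee_fin prodr_ge0.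
Qed.

(** Reversing the order of the indices makes a lower triangular matrix upper triangular, and the
    order of integration is immaterial. *)
Lemma iter_int_lower n (L : 'M[R]_n) (b : 'I_n -> V) v :
  (forall i j : 'I_n, (i < j)%N -> L i j = 0) -> (forall i, L i i = 1) ->
  iter_int f [seq comb L b i | i <- enum 'I_n] v =
  iter_int f [seq b i | i <- enum 'I_n] v.
Proof.
move=> Llow Ldiag.
pose U := \matrix_(i, j) L (rev_ord i) (rev_ord j).
rewrite -[RHS](iter_int_reindex _ _ (@rev_ord_inj n)).
rewrite [RHS](@iter_int_upper _ U); first last.
- by move=> i; rewrite mxE Ldiag oner_neq0.
- by move=> i j ji; rewrite mxE Llow //=; move: (ltn_ord i) ji; lia.
rewrite big1 ?mul1e => [|i _]; last by rewrite mxE Ldiag normr1.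
rewrite -[LHS](iter_int_reindex _ _ (@rev_ord_inj n)).
congr iter_int; apply: eq_map => i; apply/ffunP => e; rewrite !ffunE.
rewrite (reindex_inj rev_ord_inj) /=; apply: eq_bigr => j _.
by rewrite mxE.
Qed.

(** Write [P A = L U]. Here [P] only reorders the directions, the unit triangular [L] changes
    nothing, and the diagonal of [U] has a product of absolute value 1, since [P] and [L] have
    determinants of absolute value 1. *)
Lemma iter_int_unimodular n (A : 'M[R]_n) (b : 'I_n -> V) v : `|\det A| = 1 ->
  iter_int f [seq comb A b i | i <- enum 'I_n] v =
  iter_int f [seq b i | i <- enum 'I_n] v.
Proof.
case: n A b => [|n] A b detA; first by rewrite enum_ord0.
have := cormen_lup_correct A; have := cormen_lup_perm A.
have := cormen_lup_detL A; have := @cormen_lup_lower _ _ A.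
have := @cormen_lup_upper _ _ A.
case: (cormen_lup A) => [[P L] U] /= Uup Llow detL Pperm PAE.
have /is_perm_mxP[s Ps] := Pperm.
have detU : `|\prod_i U i i| = 1.
  have -> : \prod_i U i i = \det U.
    rewrite -det_tr det_trig; first by apply: eq_bigr => i _; rewrite mxE.
    by apply/is_trig_mxP => i j ij; rewrite mxE Uup.
  rewrite -[\det U]mul1r -detL -det_mulmx -[L *m U]PAE det_mulmx normrM detA.
  by rewrite Ps det_perm normrX normrN1 expr1n mulr1.
have U0 i : U i i != 0.
  apply/negP => /eqP Ui; move: detU.
  by rewrite (bigD1 i) //= Ui mul0r normr0 => /eqP; rewrite eq_sym oner_eq0.
rewrite [RHS](iter_int_upper _ _ Uup U0) -normr_prod detU mul1e.
rewrite -[RHS](@iter_int_lower _ L) => [|i j ij|i]; first last.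
- by rewrite Llow // eqxx.
- by rewrite (Llow _ _ (ltnW ij)) -val_eqE /= (ltn_eqF ij).
rewrite comb_mulmx -[L *m U]PAE -comb_mulmx.
rewrite -[LHS](iter_int_reindex _ _ (@perm_inj _ s)).
congr iter_int; apply: eq_map => i; apply/ffunP => e; rewrite [RHS]ffunE.
rewrite (bigD1 (s i)) //= big1 => [|j ji]; rewrite Ps !mxE.
  by rewrite eqxx mul1r addr0.
by rewrite eq_sym (negbTE ji) mul0r.
Qed.

End iterated_integral.

(** * Independence of the lattice frame *)

Section lattice_frames.
Variables (R : realType) (E : finType).
Notation V := {ffun E -> R}.

Definition realvec (b : {ffun E -> int}) : V := [ffun e => (b e)%:~R].

Definition eindic (P : set V) (u : V) : \bar R := (\1_P u)%:E.

Lemma lebesgue_tuple_affine (P : set V) d (v : V) (b : 'I_d -> {ffun E -> int}) :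
  lebesgue_tuple (affine_param v b @^-1` P) =
  iter_int (eindic P) [seq realvec (b i) | i <- enum 'I_d] v.
Proof.
elim: d v b => [|d IH] v b.
  rewrite enum_ord0 /= /eindic; rewrite -[LHS]/(eindic P (affine_param v b [tuple])).
  by congr eindic; apply/ffunP => e; rewrite ffunE big_ord0 addr0.
rewrite map_enum_ordS /=; apply: eq_integral => x _.
rewrite -(IH _ (fun i => b (lift ord0 i))); congr lebesgue_tuple.
apply/seteqP; split => t /=; (rewrite (_ : affine_param v b _ =
  affine_param (axpy v x (realvec (b ord0))) (fun i => b (lift ord0 i)) t) //;
  apply/ffunP => e; rewrite !ffunE big_ord_recl addrA; congr (_ + _);
  by apply: eq_bigr => i _; rewrite tnthS).
Qed.

(** Each [b' i] is the difference of two points of the common affine hull, those with parameters the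
    i-th unit vector and 0. It is thus a real combination of the [b j], and the lattice clause makes
    the coefficients integral. *)
Lemma lattice_frame_coords (P : set V) d v (b : 'I_d -> {ffun E -> int})
    d' v' (b' : 'I_d' -> {ffun E -> int}) :
  lattice_frame P v b -> lattice_frame P v' b' ->
  exists C : 'M[int]_(d', d), forall i e, b' i e = \sum_j C i j * b j e.
Proof.
move=> [hull _ latt] [hull' _ _].
have rng t' : range (affine_param v b) (affine_param v' b' t').
  by rewrite -hull hull'; exists t'.
have [t0 _ t0E] := rng [tuple 0 | j < d'].
have [|C CE] := @choice _ _ (fun i c => forall e, b' i e = \sum_j c j * b j e).
  move=> i; apply: latt.
  have [t1 _ t1E] := rng [tuple (i == j)%:R | j < d'].
  exists [tuple tnth t1 j - tnth t0 j | j < d] => e.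
  under eq_bigr do rewrite tnth_mktuple mulrBl.
  move/ffunP/(_ e): t0E; move/ffunP/(_ e): t1E; rewrite !ffunE sumrB.
  rewrite [X in _ = _ + X](bigD1 i) //= tnth_mktuple eqxx mul1r.
  rewrite [X in _ = _ + (_ + X)]big1; last first.
    by move=> j ji; rewrite tnth_mktuple eq_sym (negbTE ji) mul0r.
  rewrite [X in _ -> _ = _ + X -> _]big1; last first.
    by move=> j _; rewrite tnth_mktuple mul0r.
  lra.
by exists (\matrix_(i, j) C i j) => i e; rewrite CE; under [RHS]eq_bigr do rewrite mxE.
Qed.

(** Injectivity of the parametrisation makes coordinates along [b] unique. This is applied to the
    product of the two transition matrices between frames. *)
Lemma lattice_frame_inverse (P : set V) d v (b : 'I_d -> {ffun E -> int})
    (A : 'M[int]_d) : lattice_frame P v b ->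
  (forall i e, b i e = \sum_j A i j * b j e) -> A = 1%:M.
Proof.
move=> [_ inj _] bE; apply/matrixP => i j; apply/(@intr_inj R).
suff tE : [tuple (A i j)%:~R | j < d] =
    [tuple ((1%:M : 'M[int]_d) i j)%:~R | j < d] :> d.-tuple R.
  by have := congr1 (fun t : d.-tuple R => tnth t j) tE; rewrite !tnth_mktuple.
apply: inj; apply/ffunP => e; rewrite !ffunE; congr (_ + _).
under eq_bigr do rewrite tnth_mktuple -intrM.
under [RHS]eq_bigr do rewrite tnth_mktuple -intrM.
rewrite -!(raddf_sum (intmul (1 : R))) -bE.
congr (_%:~R); rewrite (bigD1 i) //= big1 => [|l li].
  by rewrite mxE eqxx mul1r addr0.
by rewrite mxE eq_sym (negbTE li) mul0r.
Qed.

Lemma iter_int_shift (f : V -> \bar R) (f0 : forall v, (0 <= f v)%E)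
    (mf : mfam_measurable f) (I : eqType) (r : seq I) (g : I -> R) (b : I -> V)
    (s : seq V) (v : V) : {in r, forall i, b i \in s} ->
  iter_int f s [ffun e => v e + \sum_(i <- r) g i * b i e] = iter_int f s v.
Proof.
elim: r => [|i r IH] rs.
  by congr iter_int; apply/ffunP => e; rewrite ffunE big_nil addr0.
rewrite -IH => [|j jr]; last by rewrite rs // inE jr orbT.
rewrite -[RHS](iter_int_translate f0 mf _ (g i) (rs i (mem_head _ _))).
congr iter_int; apply/ffunP => e.
by rewrite !ffunE big_cons addrCA [RHS]addrC.
Qed.

(** The two integer transition matrices are inverse to each other. Hence the dimensions agree, the
    determinant is 1 or -1, and the change of directions preserves the integral; the change of
    origin is a translation along the span of [b]. *)
Lemma lattice_frame_volume (P : set V) d v (b : 'I_d -> {ffun E -> int})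
    d' v' (b' : 'I_d' -> {ffun E -> int}) : mfam_measurable (eindic P) ->
  lattice_frame P v b -> lattice_frame P v' b' ->
  (d'`!%:R%:E * lebesgue_tuple (affine_param v' b' @^-1` P) =
   d`!%:R%:E * lebesgue_tuple (affine_param v b @^-1` P))%E.
Proof.
move=> mP F F'.
have P0 u : (0 <= eindic P u)%E by rewrite lee_fin.
have [C CE] := lattice_frame_coords F F'; have [C' C'E] := lattice_frame_coords F' F.
have comp n m (B : 'M[int]_(n, m)) (B' : 'M[int]_(m, n)) b1 b2 :
    (forall i e, b1 i e = \sum_j B i j * b2 j e) ->
    (forall i e, b2 i e = \sum_j B' i j * b1 j e) ->
    forall i (e : E), b1 i e = \sum_j (B *m B') i j * b1 j e :> int.
  move=> B1 B2 i e; rewrite B1; under eq_bigr do rewrite B2 mulr_sumr.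
  rewrite exchange_big; apply: eq_bigr => j _ /=.
  by rewrite mxE mulr_suml; apply: eq_bigr => l _; rewrite mulrA.
have C'C := lattice_frame_inverse F (comp _ _ _ _ _ _ C'E CE).
have CC' := lattice_frame_inverse F' (comp _ _ _ _ _ _ CE C'E).
have dd' : d' = d by apply/eqP; rewrite eqn_leq (mulmx1_min CC') (mulmx1_min C'C).
subst d'; congr (_ * _)%E; rewrite !lebesgue_tuple_affine.
pose A : 'M[R]_d := map_mx intr C.
have detA : `|\det A| = 1.
  have : (absz (\det C) * absz (\det C') = 1)%N by rewrite -abszM -det_mulmx CC' det1.
  by rewrite det_map_mx -intr_norm -abszE => /eqP; rewrite muln_eq1 => /andP[/eqP-> _].
have [t _ tE] : range (affine_param v b) v'.
  case: F F' => <- _ _ [-> _ _]; exists [tuple 0 | j < d] => //.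
  apply/ffunP => e; rewrite ffunE big1 ?addr0 // => j _.
  by rewrite tnth_mktuple mul0r.
have -> : [seq realvec (b' i) | i <- enum 'I_d] =
    [seq comb A (fun i => realvec (b i)) i | i <- enum 'I_d].
  apply: eq_map => i; apply/ffunP => e; rewrite !ffunE CE raddf_sum.
  by apply: eq_bigr => j _; rewrite mxE ffunE /= intrM.
rewrite (iter_int_unimodular P0 mP _ _ detA) -tE.
rewrite -[RHS](iter_int_shift P0 mP (r := enum 'I_d) (tnth t) (b := fun i => realvec (b i))).
  congr iter_int; apply/ffunP => e; rewrite !ffunE big_enum; congr (_ + _).
  by apply: eq_bigr => j _; rewrite ffunE.
by move=> i _; apply/mapP; exists i; rewrite ?mem_enum.
Qed.

Lemma normalized_volume_frame (P : set V) d v (b : 'I_d -> {ffun E -> int}) :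
  mfam_measurable (eindic P) -> lattice_frame P v b ->
  normalized_volume P = (d`!%:R%:E *
    iter_int (eindic P) [seq realvec (b i) | i <- enum 'I_d] v)%E.
Proof.
move=> mP F; rewrite -lebesgue_tuple_affine; apply: get_unique.
  by exists d, v, b.
by move=> _ [d' [v' [b' [F' ->]]]]; exact: lattice_frame_volume.
Qed.

End lattice_frames.

(** * Polytopes over a graph *)

Section graph_polytope.
Variables (R : realType) (E : finType).
Notation V := {ffun E -> R}.
Variables (free : pred E) (beta : E -> {ffun E -> int}) (v0 : V).
Hypothesis beta_free : forall e e', free e -> free e' -> beta e e' = (e == e')%:R.
Hypothesis v0_free : forall e, free e -> v0 e = 0.

(** The affine space [v0 + span (beta e)], [e] free, written as the graph of an affine map of the
    free coordinates. The two descriptions agree because [beta] is the identity matrix on the free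
    edges and [v0] vanishes there. *)
Definition on_graph (f : V) :=
  forall e', f e' = v0 e' + \sum_(e | free e) f e * (beta e e')%:~R.

Definition graph_polytope : set V := [set f : V | (forall e, 0 <= f e) /\ on_graph f].

Let bval (i : 'I_#|free|) := beta (enum_val i).

Lemma on_graph_v0 : on_graph v0.
Proof. by move=> e; rewrite big1 ?addr0 // => e0 fe0; rewrite v0_free // mul0r. Qed.

Lemma on_graph_axpy v x e : free e -> on_graph v ->
  on_graph (axpy v x (realvec R (beta e))).
Proof.
move=> fe vg e'; rewrite !ffunE vg -addrA; congr (_ + _).
under [RHS]eq_bigr do rewrite !ffunE mulrDl.
rewrite big_split /=; congr (_ + _).
rewrite [RHS](bigD1 e) //= [X in _ = _ + X]big1 => [|e1 /andP[fe1 ne]].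
  by rewrite (beta_free fe fe) eqxx mulr1 addr0.
by rewrite (beta_free fe fe1) eq_sym (negbTE ne) mulr0 mul0r.
Qed.

Lemma affine_paramE t e' : affine_param v0 bval t e' =
  v0 e' + \sum_i tnth t i * (beta (enum_val i) e')%:~R.
Proof. by rewrite ffunE. Qed.

Lemma affine_param_free t i : affine_param v0 bval t (enum_val i) = tnth t i.
Proof.
have fi : free (enum_val i) := enum_valP i.
rewrite affine_paramE v0_free // add0r (bigD1 i) //= big1 => [|j ji].
  by rewrite beta_free // eqxx mulr1 addr0.
rewrite beta_free //; last exact: (enum_valP j).
by rewrite (inj_eq enum_val_inj) (negbTE ji) mulr0.
Qed.

Lemma on_graph_range : on_graph = range (affine_param v0 bval).
Proof.
apply/seteqP; split => [f fg | _ [t _ <-]].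
  exists [tuple f (enum_val i) | i < #|free|] => //.
  apply/ffunP => e; rewrite affine_paramE fg; congr (_ + _).
  under eq_bigr do rewrite tnth_mktuple.
  by rewrite -(big_enum_val (fun e0 => f e0 * (beta e0 e)%:~R)).
move=> e; rewrite {1}affine_paramE; congr (_ + _).
under eq_bigr do rewrite -affine_param_free.
by rewrite -(big_enum_val (fun e0 => affine_param v0 bval t e0 * (beta e0 e)%:~R)).
Qed.

(** A strictly positive point is interior relative to the graph, so the line from it to any point of
    the graph contains a second point of the polytope. *)
Lemma affine_hull_graph f0 : on_graph f0 -> (forall e, 0 < f0 e) ->
  affine_hull graph_polytope = on_graph.
Proof.
move=> g0 pos; apply/seteqP; split => [f [n [p [c [pP c1 fE]]]] | f fg].
  move=> e; rewrite fE.
  under eq_bigr => i _ do rewrite (pP i).2 mulrDr.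
  rewrite big_split /= -mulr_suml c1 mul1r; congr (_ + _).
  under eq_bigr do rewrite mulr_sumr.
  rewrite exchange_big; apply: eq_bigr => e0 _ /=.
  by rewrite fE mulr_suml; apply: eq_bigr => i _; rewrite mulrA.
(* [N] is positive and bounds every [|f e - f0 e| / f0 e], so that [g] is nonnegative; then
   [f = (1 - N) f0 + N g]. *)
pose N := 1 + \sum_e `|f e - f0 e| / f0 e.
have N1 : 1 <= N by rewrite lerDl sumr_ge0 // => e _; rewrite divr_ge0 // ltW.
have N0 : 0 < N by apply: lt_le_trans N1.
pose g : V := [ffun e => f0 e + (f e - f0 e) / N].
have gP : graph_polytope g.
  split=> [e | e].
    have e0 : f0 e != 0 by rewrite gt_eqF.
    rewrite ffunE -(divfK e0 (f e - f0 e)).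
    have : `|(f e - f0 e) / f0 e| <= N.
      rewrite normrM normfV (gtr0_norm (pos e)) /N (bigD1 e) //= addrCA.
      rewrite lerDl addr_ge0 // sumr_ge0 // => e' _.
      by rewrite divr_ge0 // ltW.
    rewrite ler_norml => /andP[lo _].
    rewrite [_ * f0 e]mulrC -mulrA -[X in X + _]mulr1 -mulrDr mulr_ge0 ?(ltW (pos _)) //.
    by rewrite -(ler_pM2r N0) mul0r mulrDl mul1r divfK ?gt_eqF //; lra.
  rewrite ffunE fg g0.
  under [in RHS]eq_bigr do rewrite ffunE mulrDl mulrAC mulrBl.
  rewrite big_split /= -mulr_suml sumrB; ring.
exists 2, (fun i => if i == ord0 then f0 else g), (fun i => if i == ord0 then 1 - N else N).
split.
- by move=> i; case: ifP => // _; split => // e; exact: ltW.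
- by rewrite !big_ord_recl big_ord0 /=; ring.
- move=> e; rewrite !big_ord_recl big_ord0 /= ffunE; field.
  by rewrite gt_eqF.
Qed.

(** The coefficients of a point along the [beta e] are its own values on the free edges. This gives
    injectivity, and integer coefficients for an integer vector. *)
Lemma graph_polytope_frame f0 : on_graph f0 -> (forall e, 0 < f0 e) ->
  lattice_frame graph_polytope v0 bval.
Proof.
move=> g0 pos; split.
- by rewrite (affine_hull_graph g0 pos) on_graph_range.
- move=> t t' tt'; apply/eq_from_tnth => i.
  by rewrite -!affine_param_free tt'.
- move=> w [t wE]; exists (fun i => w (enum_val i)) => e.
  have wt i : (w (enum_val i))%:~R = tnth t i.
    have := affine_param_free t i.
    by rewrite affine_paramE v0_free ?add0r -?wE //; exact: (enum_valP i).
  apply: (@intr_inj R); rewrite wE raddf_sum; apply: eq_bigr => i _ /=.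
  by rewrite intrM wt.
Qed.

Lemma graph_polytope_measurable : mfam_measurable (eindic graph_polytope).
Proof.
move=> d T p mp.
have -> : (fun t => eindic graph_polytope (p t)) =
    EFin \o (\1_(p @^-1` graph_polytope) : T -> R) by [].
apply/measurable_EFinP/measurable_indic.
have -> : p @^-1` graph_polytope =
    \bigcap_(e in [set: E]) ([set t | 0 <= p t e] `&`
      [set t | p t e == v0 e + \sum_(e0 | free e0) p t e0 * (beta e0 e)%:~R]).
  apply/seteqP; split => t /=.
    by case=> pos og e _; split; [exact: pos | apply/eqP; exact: og].
  by move=> H; split => e; case: (H e I) => // _ /eqP.
apply: fin_bigcap_measurable; first exact: finite_finset.
move=> e _; apply: measurableI.
  have := measurable_fun_ler (@measurable_cst _ _ T R setT 0) (mp e).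
  by move=> /(_ measurableT [set true] I); rewrite setTI.
have ms : measurable_fun [set: T]
    (fun t => v0 e + \sum_(e0 | free e0) p t e0 * (beta e0 e)%:~R).
  apply: measurable_funD => //.
  under eq_fun do rewrite big_mkcond.
  apply: measurable_sum => e0; case: (free e0) => //.
  exact: measurable_funM.
have := measurable_fun_eqr (mp e) ms.
by move=> /(_ measurableT [set true] I); rewrite setTI.
Qed.

End graph_polytope.

(** * Integrals of piecewise polynomial functions *)

Section polynomial_integrals.
Variable R : realType.
Notation mu := (@lebesgue_measure R).

Lemma integral_deriv_poly (p : {poly R}) (a b : R) : a <= b ->
  (\int[mu]_(x in `[a, b]) (p^`().[x])%:E = (p.[b] - p.[a])%:E)%E.
Proof.
rewrite le_eqVlt => /predU1P[->|ab].
  by rewrite set_itv1 integral_set1 subrr.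
rewrite (@continuous_FTC2 _ (horner p^`()) (horner p)) //.
- by apply: continuous_subspaceT => x; exact: continuous_horner.
- split; first by move=> x _; exact: derivable_horner.
  + by apply: cvg_at_right_filter; exact: continuous_horner.
  + by apply: cvg_at_left_filter; exact: continuous_horner.
- by move=> x _; rewrite derivE.
Qed.

Lemma integral_piecewise_poly (p : {poly R}) (h : R -> \bar R) (r : R) : 0 <= r ->
  (forall x, h x = if 0 <= x <= r then (p^`().[x])%:E else 0%E) ->
  (\int[mu]_x h x = (p.[r] - p.[0])%:E)%E.
Proof.
move=> r0 hE; rewrite -integral_deriv_poly // [RHS]integral_mkcond.
apply: eq_integral => x _; rewrite hE patchE mem_setE /= in_itv /=.
by case: ifP.
Qed.

End polynomial_integrals.

(** * The stage polynomials *)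

Section stages.
Variables (R : realType) (K : nat) (y : R).
Notation mu := (@lebesgue_measure R).

(** The volume of the simplex of [j] nonnegative numbers with sum at most [r]: the remaining flow
    into vertex [a], once [j] source edges are free and the dropped edge takes the rest. *)
Definition last_stage (j : nat) (r : R) : R := r ^+ j / j`!%:R.

(* The [n] of the header is [n.+1] here. *)
Definition stage (n j : nat) (s r : R) : R :=
  let q := (K.+1 * n + K + j)%N in
  (s + n.+1%:R * y + r) ^+ n / n.+1`!%:R *
  (s * r ^+ q / q`!%:R + j%:R * r ^+ q.+1 / q.+1`!%:R).

Let factE q : (q.+1`!%:R : R) = q.+1%:R * q`!%:R.
Proof. by rewrite factS natrM. Qed.

Let fact0 q : (q`!%:R : R) != 0.
Proof. by rewrite pnatr_eq0 -lt0n fact_gt0. Qed.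

Lemma horner_lin_exp (r x : R) m : ((r%:P - 'X) ^+ m).[x] = (r - x) ^+ m.
Proof. by rewrite !hornerE. Qed.

Lemma deriv_lin_exp (r x : R) m :
  ((r%:P - 'X) ^+ m.+1)^`().[x] = - (m.+1%:R * (r - x) ^+ m).
Proof.
rewrite deriv_exp hornerMn hornerM horner_lin_exp derivB derivC derivX.
by rewrite !hornerE -mulr_natl /=; ring.
Qed.

Lemma integral_last_stage (j : nat) (r : R) (h : R -> \bar R) : 0 <= r ->
  (forall x, h x = if 0 <= x <= r then (last_stage j (r - x))%:E else 0%E) ->
  (\int[mu]_x h x = (last_stage j.+1 r)%:E)%E.
Proof.
move=> r0 hE.
pose p : {poly R} := - ((j.+1`!%:R^-1)%:P * (r%:P - 'X) ^+ j.+1).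
rewrite (@integral_piecewise_poly _ p _ r) //; last first.
  move=> x; rewrite hE; case: ifP => // _; congr (_%:E).
  rewrite /p derivN hornerN derivM derivC mul0r add0r hornerM hornerC.
  rewrite deriv_lin_exp /last_stage factE; field.
  by rewrite fact0 nat1r pnatr_eq0.
congr (_%:E); rewrite /p !hornerE /last_stage subrr expr0n /= subr0; ring.
Qed.

Lemma deriv_z_poly (c s r al ga x : R) (q : nat) :
  (- (c%:P * ((s%:P + 'X) * (r%:P - 'X) ^+ q.+1 * al%:P
     + ga%:P * (r%:P - 'X) ^+ q.+2)))^`().[x] =
  c * ((s + x) * (r - x) ^+ q * (q.+1%:R * al)
       + (r - x) ^+ q.+1 * (q.+2%:R * ga - al)).
Proof.
have := deriv_lin_exp r x q; have := deriv_lin_exp r x q.+1.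
have := horner_lin_exp r x q.+1.
move: (((r%:P - 'X) ^+ q.+1)%R) (((r%:P - 'X) ^+ q.+2)%R) => A B Ax Bd Ad.
rewrite !(derivM, derivN, derivD, derivX, derivC) !hornerE /= Ad Bd Ax; ring.
Qed.

Lemma horner_z_poly (c s r al ga x : R) (q : nat) :
  (- (c%:P * ((s%:P + 'X) * (r%:P - 'X) ^+ q.+1 * al%:P
     + ga%:P * (r%:P - 'X) ^+ q.+2))).[x] =
  - (c * ((s + x) * (r - x) ^+ q.+1 * al + ga * (r - x) ^+ q.+2)).
Proof.
have := horner_lin_exp r x q.+1; have := horner_lin_exp r x q.+2.
move: (((r%:P - 'X) ^+ q.+1)%R) (((r%:P - 'X) ^+ q.+2)%R) => A B Bx Ax.
by rewrite hornerN hornerM hornerD !hornerM hornerD !hornerC hornerX Bx Ax.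
Qed.

Lemma integral_stage_z (n j : nat) (s r : R) (h : R -> \bar R) : 0 <= r ->
  (forall x, h x = if 0 <= x <= r then (stage n j (s + x) (r - x))%:E else 0%E) ->
  (\int[mu]_x h x = (stage n j.+1 s r)%:E)%E.
Proof.
rewrite /stage addnS; move: (K.+1 * n + K + j)%N => q r0 hE.
pose c : R := (s + n.+1%:R * y + r) ^+ n / n.+1`!%:R.
(* The coefficients solve [(q+1) al = 1/q!] and [(q+2) ga - al = j/(q+1)!]. This primitive vanishes
   at [r], and its value at 0 is minus the next stage. *)
pose p : {poly R} := - (c%:P * ((s%:P + 'X) * (r%:P - 'X) ^+ q.+1 * (q.+1`!%:R^-1)%:P
  + (j.+1%:R / q.+2`!%:R)%:P * (r%:P - 'X) ^+ q.+2)).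
rewrite (@integral_piecewise_poly _ p _ r) //; last first.
  move=> x; rewrite hE; case: ifP => // _; congr (_%:E).
  rewrite (_ : s + x + n.+1%:R * y + (r - x) = s + n.+1%:R * y + r); last by ring.
  rewrite -/c /p deriv_z_poly; congr (_ * _).
  rewrite (factE q.+1) (factE q) -(natr1 j).
  have := fact0 q; have : q.+1%:R != 0 :> R by []; have : q.+2%:R != 0 :> R by [].
  move: (q.+1%:R) (q.+2%:R) (q`!%:R) ((r - x) ^+ q.+1) ((r - x) ^+ q) => q1 q2 F u w.
  by move=> q20 q10 F0; field; rewrite F0 q10 q20.
congr (_%:E); rewrite -/c /p !horner_z_poly subrr subr0.
have z m : (0 : R) ^+ m.+1 = 0 by rewrite exprS mul0r.
rewrite !z; ring.
Qed.

(** Vertex [a] has no sink edge besides the chain edge, so the volume left behind the last separate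
    sink edge does not depend on [x]; the integral only contributes the length [s]. *)
Lemma integral_stage_w0 (s r : R) (h : R -> \bar R) : 0 <= s ->
  (forall x, h x = if 0 <= x <= s then (last_stage K r)%:E else 0%E) ->
  (\int[mu]_x h x = (stage 0 0 s r)%:E)%E.
Proof.
move=> s0 hE.
rewrite (@integral_piecewise_poly _ ((last_stage K r)%:P * 'X) _ s) //; last first.
  by move=> x; rewrite hE derivM derivC derivX; case: ifP => // _; rewrite !hornerE.
congr (_%:E); rewrite !hornerM !hornerC !hornerX /stage /last_stage muln0 add0n addn0.
by rewrite expr0 (_ : 1`! = 1)%N // divr1 mul1r !mul0r mulr0 subr0 addr0 mulrC mulrA.
Qed.

Lemma deriv_w_poly (c s t x : R) (n : nat) :
  (- (c%:P * ((s%:P - 'X) * (t%:P - 'X) ^+ n.+1)))^`().[x] =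
  c * (t - x) ^+ n * (t - x + n.+1%:R * (s - x)).
Proof.
have := deriv_lin_exp t x n; have := horner_lin_exp t x n.+1.
move: (((t%:P - 'X) ^+ n.+1)%R) => A Ax Ad.
rewrite !(derivM, derivN, derivD, derivX, derivC) !hornerE /= Ad Ax exprS; ring.
Qed.

Lemma horner_w_poly (c s t x : R) (n : nat) :
  (- (c%:P * ((s%:P - 'X) * (t%:P - 'X) ^+ n.+1))).[x] =
  - (c * ((s - x) * (t - x) ^+ n.+1)).
Proof.
have := horner_lin_exp t x n.+1; move: (((t%:P - 'X) ^+ n.+1)%R) => A Ax.
by rewrite hornerN !hornerM hornerD hornerN !hornerC hornerX Ax.
Qed.

Lemma integral_stage_w (n : nat) (s r : R) (h : R -> \bar R) : 0 <= s ->
  (forall x, h x = if 0 <= x <= s then (stage n K.+1 (s - x + y) r)%:E else 0%E) ->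
  (\int[mu]_x h x = (stage n.+1 0 s r)%:E)%E.
Proof.
rewrite /stage addn0 (_ : (K.+1 * n + K + K.+1 = K.+1 * n.+1 + K)%N); last by lia.
(* As [q + 1 = k (n + 2)], the two terms of the stage share the factor [r^q / q!] and combine into
   the single derivative of [deriv_w_poly]. *)
have : (K.+1 * n.+1 + K).+1`!%:R = K.+1%:R * n.+2%:R * (K.+1 * n.+1 + K)`!%:R :> R.
  by rewrite factE; congr (_ * _); rewrite -natrM; congr (_%:R); lia.
move: (K.+1 * n.+1 + K)%N => q qE s0 hE.
pose c : R := r ^+ q / q`!%:R / n.+2`!%:R.
pose p : {poly R} := - (c%:P * ((s%:P - 'X) * ((s + n.+2%:R * y + r)%:P - 'X) ^+ n.+1)).
rewrite (@integral_piecewise_poly _ p _ s) //; last first.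
  move=> x; rewrite hE; case: ifP => // _; congr (_%:E).
  rewrite /p deriv_w_poly qE /c (factE n.+1).
  rewrite (_ : s - x + y + n.+1%:R * y + r = s + n.+2%:R * y + r - x); last first.
    by rewrite -(natr1 n.+1); ring.
  have := fact0 q; have := fact0 n.+1; have : K.+1%:R != 0 :> R by [].
  have : n.+2%:R != 0 :> R by []; have : n.+2%:R = 1 + n.+1%:R :> R by rewrite nat1r.
  move: (n.+2%:R) => n2; rewrite (exprS r q).
  move: (n.+1%:R) (K.+1%:R) (q`!%:R) (n.+1`!%:R) (r ^+ q) => n1 k1 F G u.
  move: ((s + n2 * y + r - x) ^+ n) => w.
  move=> n2E n20 k10 G0 F0; field: n2E; by rewrite F0 G0 k10 n20.
congr (_%:E); rewrite /p /c !horner_w_poly subrr !subr0.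
ring.
Qed.

End stages.

(** * The caracol polytope *)

Section caracol.
Variables (R : realType) (K A : nat) (X y : R).

(** Here [k = K + 1], [a = A + 1] and [X = kx]. The edges [ch l], [wo i] and [inr (j, i)] are
    [(l+1, l+2)], [(i+1, a+1)] and the [j]-th copy of [(0, i+1)]; [pmax] is the dropped edge from 0
    to [a]. *)
Let Ed : finType := ('I_A.+1 + 'I_A + 'I_K.+1 * 'I_A.+1)%type.
Notation V := {ffun Ed -> R}.
Notation ch l := (inl (inl l) : Ed).
Notation wo i := (inl (inr i) : Ed).
Notation pmax := ((ord_max, ord_max) : 'I_K.+1 * 'I_A.+1).

Definition conserves (f : V) := \sum_p f (inr p) = X /\ forall l : 'I_A.+1,
  f (ch l) + \sum_(i : 'I_A | i == l :> nat) f (wo i) -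
  (\sum_(m : 'I_A.+1 | m.+1 == l) f (ch m) +
   \sum_(p : 'I_K.+1 * 'I_A.+1 | p.2 == l) f (inr p)) = y.

Definition solved (f : V) := \sum_p f (inr p) = X /\ forall l : 'I_A.+1,
  f (ch l) = l.+1%:R * y + \sum_(p : 'I_K.+1 * 'I_A.+1 | (p.2 <= l)%N) f (inr p)
             - \sum_(i : 'I_A | (i <= l)%N) f (wo i).

(** The formula for the chain flows is the sum of the conservation equations up to a vertex. It
    satisfies these equations ([SE]), and they determine the chain flows one after the other. *)
Lemma solved_conserves f : solved f <-> conserves f.
Proof.
pose S (l : nat) := l.+1%:R * y + \sum_(p : 'I_K.+1 * 'I_A.+1 | (p.2 <= l)%N) f (inr p)
             - \sum_(i : 'I_A | (i <= l)%N) f (wo i).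
have splitS (I : finType) (g : I -> nat) (F : I -> R) l :
    \sum_(i | (g i <= l.+1)%N) F i =
    \sum_(i | g i == l.+1) F i + \sum_(i | (g i <= l)%N) F i.
  rewrite (bigID (fun i => g i == l.+1)) /=; congr (_ + _);
  by apply: eq_bigl => i; lia.
have split0 (I : finType) (g : I -> nat) (F : I -> R) :
    \sum_(i | (g i <= 0)%N) F i = \sum_(i | g i == 0%N) F i.
  by apply: eq_bigl => i; rewrite leqn0.
have SE (l : 'I_A.+1) : S l + \sum_(i : 'I_A | i == l :> nat) f (wo i) -
    (\sum_(m : 'I_A.+1 | m.+1 == l) S m +
     \sum_(p : 'I_K.+1 * 'I_A.+1 | p.2 == l) f (inr p)) = y.
  case: l => [[|l] lA] /=.
    rewrite [X in _ - (X + _)]big_pred0 //.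
    rewrite /S (split0 _ (fun p : 'I_K.+1 * 'I_A.+1 => p.2 : nat)).
    by rewrite (split0 _ (fun i : 'I_A => i : nat)); ring.
  have lA' : (l < A.+1)%N by exact: ltnW.
  rewrite [X in _ - (X + _)](big_pred1 (Ordinal lA')); last first.
    by move=> m; apply/eqP/eqP => [[ml]|->] //; exact: val_inj.
  rewrite /S /= (splitS _ (fun p : 'I_K.+1 * 'I_A.+1 => p.2 : nat)).
  by rewrite (splitS _ (fun i : 'I_A => i : nat)) -(natr1 l.+1); ring.
split=> -[sX H]; split=> // l.
  rewrite H -/(S l) -[RHS](SE l); congr (_ - (_ + _)).
  by apply: eq_bigr => m _; rewrite H.
have [n] := ubnP (l : nat); elim: n l => // n IH l ln.
have := H l; rewrite -[in X in _ = X -> _](SE l) -/(S l).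
rewrite [X in _ - (X + _) = _](eq_bigr (fun m : 'I_A.+1 => S m)); first by lra.
by move=> m /eqP ml; rewrite IH //; lia.
Qed.

Definition is_free (e : Ed) : bool :=
  match e with
  | inl (inl _) => false
  | inl (inr _) => true
  | inr p => p != pmax
  end.

(* The circulation through the free edge e that is closed by the dropped edge
   [inr pmax] and the chain. It vanishes for [e = inr pmax], so that sums over free
   edges may range over all source edges. *)
Definition beta_fun (e e' : Ed) : int :=
  match e, e' with
  | inl (inr i), inl (inl l) => - (i <= l)%N%:R
  | inl (inr i), inl (inr i') => (i == i')%:R
  | inr p, inl (inl l) => (p.2 <= l)%N%:R - (A <= l)%N%:R
  | inr p, inr q => (p == q)%:R - (q == pmax)%:R
  | _, _ => 0
  end.

Definition beta (e : Ed) : {ffun Ed -> int} := [ffun e' => beta_fun e e'].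

(** The flow whose free coordinates are all 0: the whole source flow [X] takes the edge [pmax], and
    the chain accumulates the inputs [y]. *)
Definition base_fun (e : Ed) : R :=
  match e with
  | inl (inl l) => l.+1%:R * y + (A <= l)%N%:R * X
  | inl (inr _) => 0
  | inr p => (p == pmax)%:R * X
  end.

Definition base_flow : V := [ffun e => base_fun e].

Lemma beta_free e e' : is_free e -> is_free e' -> beta e e' = (e == e')%:R.
Proof.
case: e e' => [[l|i]|p] [[l'|i']|p'] //= pf pf'; rewrite ffunE //=.
by rewrite (negbTE pf') subr0.
Qed.

Lemma base_flow_free e : is_free e -> base_flow e = 0.
Proof. by case: e => [[l|i]|p] //= pf; rewrite ffunE //= (negbTE pf) mul0r. Qed.

Lemma sum_free (f : V) e' :
  \sum_(e | is_free e) f e * (beta e e')%:~R =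
  \sum_i f (wo i) * (beta (wo i) e')%:~R + \sum_p f (inr p) * (beta (inr p) e')%:~R.
Proof.
rewrite !big_sumType /= big_pred0 // add0r; congr (_ + _).
rewrite [RHS](bigD1 pmax) //= [X in _ = X + _](_ : _ = 0) ?add0r //.
rewrite ffunE; case: e' => [[l|i]|q] /=; rewrite ?subrr ?mulr0 //.
by rewrite eq_sym subrr mulr0.
Qed.

Lemma on_graph_solved f : on_graph is_free beta base_flow f <-> solved f.
Proof.
have eqP' (p : 'I_K.+1 * 'I_A.+1) :
    \sum_q f (inr q) * (beta (inr q) (inr p))%:~R =
    f (inr p) - (p == pmax)%:R * \sum_q f (inr q).
  under eq_bigr => q _ do rewrite ffunE /= rmorphB /= mulrBr.
  rewrite sumrB -mulr_suml; congr (_ - _); last by rewrite mulrC; case: (p == _).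
  rewrite (bigD1 p) //= eqxx mulr1 big1 ?addr0 // => q qp.
  by rewrite (negbTE qp) mulr0.
have chE (l : 'I_A.+1) : \sum_(e | is_free e) f e * (beta e (ch l))%:~R =
    \sum_(p : 'I_K.+1 * 'I_A.+1 | (p.2 <= l)%N) f (inr p)
    - \sum_(i : 'I_A | (i <= l)%N) f (wo i) - (A <= l)%N%:R * \sum_p f (inr p).
  rewrite sum_free.
  under eq_bigr => i _ do rewrite ffunE /= rmorphN /= mulrN.
  rewrite sumrN.
  under [X in _ + X]eq_bigr => p _ do rewrite ffunE /= rmorphB /= mulrBr.
  rewrite sumrB -mulr_suml.
  have mk (I : finType) (Q : pred I) (F : I -> R) :
      \sum_i F i * ((Q i)%:R : int)%:~R = \sum_(i | Q i) F i.
    rewrite [RHS]big_mkcond; apply: eq_bigr => i _.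
    by case: (Q i); rewrite ?mulr1 ?mulr0.
  rewrite (mk _ (fun i : 'I_A => (i <= l)%N)).
  rewrite (mk _ (fun p : 'I_K.+1 * 'I_A.+1 => (p.2 <= l)%N)).
  have -> : (((A <= l)%N%:R : int)%:~R : R) = (A <= l)%N%:R by case: (A <= l)%N.
  ring.
split=> [fg | [sX H] [[l|i]|p]].
(* At [pmax] the graph equation reads [f pmax = X + f pmax - sum], which fixes the total source
   flow. *)
- have sX : \sum_p f (inr p) = X.
    have := fg (inr pmax); rewrite ffunE /= eqxx sum_free eqP' eqxx !mul1r.
    rewrite big1 => [|i _]; last by rewrite ffunE mulr0.
    lra.
  split=> // l; rewrite fg chE sX ffunE /base_fun; ring.
- by rewrite H chE sX ffunE /base_fun; ring.
- rewrite sum_free ffunE /base_fun add0r [X in _ = _ + X]big1 => [|p _]; last first.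
    by rewrite ffunE mulr0.
  rewrite addr0 (bigD1 i) //= big1 => [|i' ii']; rewrite ffunE /=.
    by rewrite eqxx mulr1 addr0.
  by rewrite (negbTE ii') mulr0.
- rewrite sum_free eqP' sX ffunE /base_fun big1 => [|i _]; last by rewrite ffunE mulr0.
  ring.
Qed.

Lemma on_graph_conserves v : on_graph is_free beta base_flow v -> conserves v.
Proof. by move=> /on_graph_solved /solved_conserves. Qed.

Hypotheses (X0 : 0 < X) (y0 : 0 <= y).

(** The source flow is split equally, [z] per source edge, and each of the [a - 1] sink edges gets
    [z / a]. Their total stays below [z], which every chain edge has received at least once, so the
    chain flows are positive. *)
Lemma exists_positive_flow : exists2 f : V,
  on_graph is_free beta base_flow f & forall e, 0 < f e.
Proof.
pose z : R := X / (#|{: 'I_K.+1 * 'I_A.+1}|)%:R.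
pose d : R := z / A.+1%:R.
have card0 : (0 < #|{: 'I_K.+1 * 'I_A.+1}|)%N by apply/card_gt0P; exists pmax.
have z0 : 0 < z by rewrite divr_gt0 // ltr0n.
have d0 : 0 < d by rewrite divr_gt0 // ltr0n.
pose g (e : Ed) : R := match e with
  | inl (inl l) => l.+1%:R * y + \sum_(p : 'I_K.+1 * 'I_A.+1 | (p.2 <= l)%N) z
             - \sum_(i : 'I_A | (i <= l)%N) d
  | inl (inr _) => d
  | inr _ => z end.
pose f : V := [ffun e => g e].
exists f => [|[[l|i]|p]]; rewrite ?ffunE //.
  apply/on_graph_solved; split=> [|l].
    under eq_bigr do rewrite ffunE.
    by rewrite sumr_const -[z *+ _]mulr_natr divfK // pnatr_eq0 -lt0n.
  rewrite ffunE; congr (_ + _ - _); apply: eq_bigr => e _; by rewrite ffunE.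
have h1 : z <= \sum_(p : 'I_K.+1 * 'I_A.+1 | (p.2 <= l)%N) z.
  by rewrite (bigD1 (ord0, ord0)) //= lerDl sumr_ge0 // => *; exact: ltW.
have h2 : \sum_(i : 'I_A | (i <= l)%N) d <= \sum_(i : 'I_A) d.
  by rewrite [leRHS](bigID (fun i : 'I_A => (i <= l)%N)) /= lerDl sumr_ge0 // => *; exact: ltW.
have h3 : \sum_(i : 'I_A) d < z.
  rewrite sumr_const card_ord -[d *+ A]mulr_natr /d -mulrA gtr_pMr //.
  by rewrite mulrC ltr_pdivrMr ?ltr0n // mul1r ltr_nat.
have h4 : 0 <= l.+1%:R * y by rewrite mulr_ge0.
rewrite /g; lra.
Qed.

(** * Integration vertex by vertex *)

Local Notation mcar_polytope := (graph_polytope is_free beta base_flow).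
Local Notation vec e := (realvec R (beta e)).

(* The edges integrated over once the vertices 1, ..., i are done, together with
   the source edges (0, i+1) of index at least j. *)
Definition settled (i j : nat) (e : Ed) : bool :=
  match e with
  | inl (inl l) => (l < i)%N
  | inl (inr m) => (m < i)%N
  | inr p => (p.2 < i)%N || (p.2 == i :> nat) && (j <= p.1)%N
  end.

(** For [i <= A], the pending directions leave all settled edges other than [pmax] unchanged, and
    nonnegative steps can only lower [pmax], which holds the undistributed source flow. Where this
    test fails, the remaining volume is 0. *)
Definition feasible (i j : nat) (v : V) : bool :=
  [forall e, (settled i j e || (e == inr pmax)) ==> (0 <= v e)].

(** The directions are known only up to order, as they come from an enumeration of the free edges;
    [vol_rem] then allows any of them to be integrated next. *)
Definition pending (i j : nat) (s : seq Ed) : Prop :=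
  uniq s /\ forall e, (e \in s) = is_free e && ~~ settled i j e.

(** Since pending coordinates are still 0, a step along an edge makes the integration variable equal
    to the flow on that edge. *)
Definition resting (s : seq Ed) (v : V) : Prop := {in s, forall e, v e = 0}.

Lemma feasibleP i j (v : V) :
  reflect (forall e, settled i j e || (e == inr pmax) -> 0 <= v e) (feasible i j v).
Proof. by apply: (iffP forallP) => H e; [exact/implyP/H | apply/implyP; exact: H]. Qed.

Lemma pending_rem i j i' j' e s : pending i j s -> is_free e ->
  (forall e', is_free e' -> settled i' j' e' = settled i j e' || (e' == e)) ->
  pending i' j' (rem e s).
Proof.
move=> [us sE] fe H; split; first exact: rem_uniq.
move=> e'; rewrite mem_rem_uniq // inE sE.
by case fe': (is_free e'); rewrite ?andbF //= H // negb_or andbC.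
Qed.

Lemma resting_rem i j e x s v : pending i j s -> e \in s -> resting s v ->
  resting (rem e s) (axpy v x (vec e)).
Proof.
move=> [us sE] es vs e'; rewrite mem_rem_uniq // => /andP[ne e's].
have /andP[fe _] : is_free e && ~~ settled i j e by rewrite -sE.
have /andP[fe' _] : is_free e' && ~~ settled i j e' by rewrite -sE.
by rewrite !ffunE vs // -[beta_fun _ _](ffunE (beta_fun e)) -/(beta e) beta_free //
  eq_sym (negbTE ne) mulr0 addr0.
Qed.

Lemma settled_z i j (jo : 'I_K.+1) (io : 'I_A.+1) e : jo = j :> nat -> io = i :> nat ->
  settled i j e = settled i j.+1 e || (e == inr (jo, io)).
Proof.
move=> jE iE; case: e => [[l|m]|[p1 p2]] /=; rewrite ?orbF //.
rewrite -[inr _ == inr _]/((p1 == jo) && (p2 == io)) -!val_eqE /= jE iE.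
lia.
Qed.

(** The step puts [x] on the edge itself, takes [x] from [pmax], and otherwise alters only chain
    edges that are not yet settled. *)
Lemma feasible_z i j (jo : 'I_K.+1) (io : 'I_A.+1) (v : V) x :
  jo = j :> nat -> io = i :> nat -> (jo, io) != pmax -> v (inr (jo, io)) = 0 ->
  feasible i j (axpy v x (vec (inr (jo, io)))) =
  feasible i j.+1 v && (0 <= x <= v (inr pmax)).
Proof.
move=> jE iE np v0.
have at_p : axpy v x (vec (inr (jo, io))) (inr (jo, io)) = x.
  by rewrite !ffunE /= v0 eqxx (negbTE np) subr0 mulr1 add0r.
have at_max : axpy v x (vec (inr (jo, io))) (inr pmax) = v (inr pmax) - x.
  by rewrite !ffunE /= eqxx (negbTE np) sub0r mulrN mulr1.
have other e : settled i j.+1 e -> e != inr pmax ->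
    axpy v x (vec (inr (jo, io))) e = v e.
  move=> se ne; rewrite !ffunE.
  have -> : beta_fun (inr (jo, io)) e = 0; last by rewrite mulr0 addr0.
  case: e se ne => [[l|m]|p] //= se ne.
    have ioA := ltn_ord io; have -> : (io <= l)%N = false by lia.
    by have -> : (A <= l)%N = false by lia.
  have -> : (p == pmax) = false by apply/negbTE; apply: contra ne => /eqP ->.
  case: eqP => [pE|_]; last by rewrite subr0.
  by move: se; rewrite -pE /= jE iE; lia.
apply/feasibleP/andP => [H | [/feasibleP H /andP[x0 xr]] e].
  have hx : 0 <= x.
    by rewrite -at_p H // (settled_z _ jE iE) eqxx orbT.
  have hr : 0 <= v (inr pmax) - x by rewrite -at_max H // eqxx orbT.
  split; last by rewrite hx -subr_ge0.
  apply/feasibleP => e; have [->|ne] := eqVneq e (inr pmax); first by lra.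
  rewrite orbF => se; rewrite -(other e) // H //.
  by rewrite (settled_z _ jE iE) se.
have [->|ne] := eqVneq e (inr pmax); first by rewrite at_max subr_ge0.
rewrite orbF (settled_z _ jE iE) => /orP[se | /eqP ->]; last by rewrite at_p.
by rewrite other // H // se.
Qed.

Lemma settled_w (i : 'I_A) (io : 'I_A.+1) e : io = i :> nat ->
  settled i.+1 K.+1 e = [|| settled i 0 e, e == wo i | e == ch io].
Proof.
move=> iE; case: e => [[l|m]|[p1 p2]] /=.
- have -> : (ch l == ch io) = (l == io) by [].
  by rewrite -val_eqE /= iE; lia.
- have -> : (wo m == wo i) = (m == i) by [].
  have -> : (wo m == ch io) = false by [].
  by rewrite -val_eqE /=; lia.
- have -> : (inr (p1, p2) == ch io) = false by [].
  by have := ltn_ord p1; lia.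
Qed.

(** The step diverts [x] from the chain edges starting at [ch io]. Of the altered edges, only [wo i]
    and [ch io] become settled, which bounds [x] on both sides. *)
Lemma feasible_w (i : 'I_A) (io : 'I_A.+1) (v : V) x : io = i :> nat -> v (wo i) = 0 ->
  feasible i.+1 K.+1 (axpy v x (vec (wo i))) =
  feasible i 0 v && (0 <= x <= v (ch io)).
Proof.
move=> iE v0.
have at_w : axpy v x (vec (wo i)) (wo i) = x.
  by rewrite !ffunE /= v0 eqxx mulr1 add0r.
have at_c : axpy v x (vec (wo i)) (ch io) = v (ch io) - x.
  by rewrite !ffunE /= iE leqnn mulrN mulr1.
have other e : settled i 0 e || (e == inr pmax) ->
    axpy v x (vec (wo i)) e = v e.
  move=> se; rewrite !ffunE; have -> : beta_fun (wo i) e = 0; last by rewrite mulr0 addr0.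
  case: e se => [[l|m]|p] //=; rewrite orbF => se.
    by rewrite leqNgt se.
  by case: eqP se => // ->; rewrite ltnn.
apply/feasibleP/andP => [H | [/feasibleP H /andP[x0 xr]] e].
  have hx : 0 <= x.
    by rewrite -at_w H // (settled_w _ iE) eqxx !orbT.
  have hr : 0 <= v (ch io) - x by rewrite -at_c H // (settled_w _ iE) eqxx !orbT.
  split; last by rewrite hx -subr_ge0.
  apply/feasibleP => e se; rewrite -(other e) // H // (settled_w _ iE).
  by case/orP: se => ->; rewrite ?orbT.
rewrite (settled_w _ iE) -!orbA => /or4P[se|/eqP->|/eqP->|se]; rewrite ?at_w ?at_c //.
- by rewrite other ?se // H // se.
- by rewrite subr_ge0.
- by rewrite other ?se ?orbT // H // se orbT.
Qed.

(** At vertex [a] the copy of index [K] is the dropped edge [pmax], so only [K] source edges remain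
    to be integrated there. *)
Lemma settled_last e : is_free e -> settled A K e = settled A K.+1 e.
Proof.
case: e => [[l|m]|[p1 p2]] //= np; congr (_ || _).
case: eqP => //= pA; have := ltn_ord p1.
rewrite ltnS leq_eqVlt => /orP[/eqP p1K|]; last by lia.
by case/eqP: np; congr (_, _); apply: val_inj.
Qed.

Lemma feasible_last v : feasible A K v = feasible A K.+1 v.
Proof.
apply: eq_forallb => e; case: (boolP (is_free e)) => [/settled_last -> //|].
by case: e => [[l|m]|p] //=; rewrite negbK => /eqP ->; rewrite eqxx !orbT.
Qed.

(** By conservation at the tail of the chain edge: the inflows and [y] are nonnegative, and no flow
    leaves for the sink yet. This guarantees that the range of the next sink variable is an interval
    starting at 0. *)
Lemma chain_ge0 i j (v : V) (io : 'I_A.+1) : conserves v -> io = i :> nat -> feasible i j v ->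
  (forall p : 'I_K.+1 * 'I_A.+1, p.2 = io -> 0 <= v (inr p)) ->
  (forall m : 'I_A, m = i :> nat -> v (wo m) = 0) -> 0 <= v (ch io).
Proof.
move=> [_ /(_ io)] H iE /feasibleP ok zp wz.
move: H; rewrite big1 => [|m /eqP mi]; last by rewrite wz // mi iE.
have h1 : 0 <= \sum_(m < A.+1 | m.+1 == io) v (ch m).
  by apply: sumr_ge0 => m /eqP mi; apply: ok => /=; rewrite -iE -mi ltnSn.
have h2 : 0 <= \sum_(p : 'I_K.+1 * 'I_A.+1 | p.2 == io) v (inr p).
  by apply: sumr_ge0 => p /eqP pi; apply: zp.
by move: y0; lra.
Qed.

Let polytope_ge0 v : (0 <= eindic mcar_polytope v)%E.
Proof. by rewrite lee_fin. Qed.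

Let polytope_measurable : mfam_measurable (eindic mcar_polytope).
Proof. exact: graph_polytope_measurable. Qed.

Local Notation vol s v := (iter_int (eindic mcar_polytope) [seq vec e | e <- s] v).

Lemma vol_rem (s : seq Ed) e v : e \in s ->
  vol s v = (\int[lebesgue_measure]_x vol (rem e s) (axpy v x (vec e)))%E.
Proof.
move=> es; rewrite (iter_int_perm polytope_ge0 polytope_measurable v
  (perm_map (fun e => vec e) (perm_to_rem es))).
by [].
Qed.

Let on_graph_step v x e : is_free e -> on_graph is_free beta base_flow v ->
  on_graph is_free beta base_flow (axpy v x (vec e)).
Proof. exact: on_graph_axpy beta_free v x e. Qed.

(** Separates the part of feasibility that does not involve [x] from the range of [x]. *)
Lemma integral_if0 (b : bool) (h : R -> \bar R) (g : R -> bool)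
    (k : R -> \bar R) (I : \bar R) :
  (forall x, h x = if b && g x then k x else 0%E) ->
  (b -> (forall x, h x = if g x then k x else 0%E) ->
    (\int[lebesgue_measure]_x h x = I)%E) ->
  (\int[lebesgue_measure]_x h x = if b then I else 0)%E.
Proof.
case: b => hE H; first exact: H.
by rewrite integral0_eq.
Qed.

Lemma settled_all p : settled A 0 (inr p).
Proof. by rewrite /= andbT orbC -leq_eqVlt -ltnS ltn_ord. Qed.

Lemma volume_last j s v : (j <= K)%N -> pending A j s ->
  on_graph is_free beta base_flow v -> resting s v ->
  vol s v = if feasible A j v then (last_stage j (v (inr pmax)))%:E else 0%E.
Proof.
elim: j s v => [|j IH] s v jK ps vg vs.
  have s0 : s = [::].
    case: s ps {vs} => // e s [_ /(_ e)]; rewrite mem_head => /esym/andP[].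
    by case: e => [[l|m]|p] // _; rewrite ?settled_all //= ltn_ord.
  rewrite s0 /= /eindic /last_stage expr0 divr1.
  case: ifPn => [ok|nok]; rewrite /indic.
    rewrite mem_set //; split => // e.
    case: (boolP (settled A 0 e)) => [se|].
      by move/feasibleP: ok; apply; rewrite se.
    (* The only edge not settled is the last chain edge, whose sign follows from conservation. *)
    case: e => [[l|m]|p]; rewrite ?settled_all //= ?ltn_ord // => lA.
    apply: (chain_ge0 (on_graph_conserves vg) _ ok).
    - by apply/eqP; have := ltn_ord l; rewrite ltnS eqn_leq => ->; rewrite leqNgt.
    - by move=> p _; move/feasibleP: ok; apply; rewrite settled_all.
    - by move=> m mA; have := ltn_ord m; rewrite mA ltnn.
  rewrite memNset // => -[vpos _]; case/negP: nok; apply/feasibleP => e _.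
  exact: vpos.
pose jo : 'I_K.+1 := inord j; have jE : jo = j :> nat by rewrite inordK // ltnW.
pose io : 'I_A.+1 := ord_max; have iE : io = A :> nat by [].
have np : (jo, io) != pmax.
  by apply/eqP => -[/(congr1 val) /=]; rewrite jE => jK'; rewrite jK' ltnn in jK.
have es : inr (jo, io) \in s.
  by rewrite ps.2 /= np ltnn eqxx jE /= -ltnNge.
rewrite (vol_rem _ es).
apply: (@integral_if0 _ _ (fun x => 0 <= x <= v (inr pmax))
  (fun x => (last_stage j (v (inr pmax) - x))%:E)) => [x|ok hE].
  rewrite IH; first last.
  - exact: (resting_rem x ps es vs).
  - exact: on_graph_step.
  - by apply: (pending_rem ps) => // e' _; exact: settled_z.
  - exact: ltnW.
  rewrite (feasible_z x jE iE np (vs _ es)).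
  by rewrite !ffunE /= eqxx (negbTE np) sub0r mulrN mulr1.
apply: integral_last_stage hE.
by move/feasibleP: ok; apply; rewrite eqxx orbT.
Qed.

(** The claim of the induction over stages; [io] stands for the number [i] as an index of chain
    edges. *)
Definition volume_at (n j : nat) (i : 'I_A) (io : 'I_A.+1) : Prop := forall s v,
  pending i j s -> on_graph is_free beta base_flow v -> resting s v ->
  vol s v = if feasible i j v
            then (stage K y n j (v (ch io)) (v (inr pmax)))%:E else 0%E.

Lemma volume_z n j (i : 'I_A) (io : 'I_A.+1) : io = i :> nat -> (j <= K)%N ->
  volume_at n j i io -> volume_at n j.+1 i io.
Proof.
move=> iE jK IH s v ps vg vs; have iA := ltn_ord i.
pose jo : 'I_K.+1 := inord j; have jE : jo = j :> nat by rewrite inordK.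
have np : (jo, io) != pmax.
  by apply/eqP => -[_ /(congr1 val) /=]; rewrite iE => iA'; rewrite iA' ltnn in iA.
have es : inr (jo, io) \in s by rewrite ps.2 /= np iE jE ltnn eqxx /= -ltnNge.
rewrite (vol_rem _ es).
apply: (@integral_if0 _ _ (fun x => 0 <= x <= v (inr pmax))
  (fun x => (stage K y n j (v (ch io) + x) (v (inr pmax) - x))%:E)) => [x|ok hE].
  rewrite IH; first last.
  - exact: (resting_rem x ps es vs).
  - exact: on_graph_step.
  - by apply: (pending_rem ps) => // e' _; exact: settled_z.
  rewrite (feasible_z x jE iE np (vs _ es)) !ffunE /= eqxx (negbTE np).
  by rewrite sub0r mulrN mulr1 leqnn [(A <= _)%N]leqNgt iE iA subr0 mulr1.
apply: integral_stage_z hE.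
by move/feasibleP: ok; apply; rewrite eqxx orbT.
Qed.

Lemma wo_pending (i : 'I_A) j s : pending i j s -> wo i \in s.
Proof. by move=> ps; rewrite ps.2 /= ltnn. Qed.

Lemma chain_ge0_w (i : 'I_A) (io : 'I_A.+1) s v : io = i :> nat -> pending i 0 s ->
  on_graph is_free beta base_flow v -> resting s v -> feasible i 0 v -> 0 <= v (ch io).
Proof.
move=> iE ps vg vs ok; apply: (chain_ge0 (on_graph_conserves vg) iE ok) => [p pi|m mi].
  by move/feasibleP: ok; apply; rewrite /= pi iE eqxx orbT.
by rewrite (_ : m = i) ?vs //; [exact: wo_pending ps | exact: val_inj].
Qed.

Lemma pending_w (i : 'I_A) s : pending i 0 s -> pending i.+1 K.+1 (rem (wo i) s).
Proof.
move=> ps; apply: (pending_rem ps) => // e fe.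
rewrite (settled_w (io := inord i)); last by rewrite inordK // ltnS ltnW.
by rewrite orbA [X in _ || X](_ : _ = false) ?orbF //; case: e fe => [[]|].
Qed.

(** At the next vertex all source edges and the sink edge are still pending, hence carry 0, and
    conservation only adds [y]. *)
Lemma chain_next (i i' : 'I_A) (io io' : 'I_A.+1) s v : io = i :> nat ->
  io' = i' :> nat -> i' = i.+1 :> nat -> pending i' K.+1 s ->
  on_graph is_free beta base_flow v -> resting s v -> v (ch io') = v (ch io) + y.
Proof.
move=> iE iE' ii' ps /on_graph_conserves[_ /(_ io')] H vs; move: H.
rewrite big1 => [|m /eqP mi]; last first.
  by rewrite (_ : m = i') ?vs //; [exact: wo_pending ps | apply: val_inj; rewrite /= mi].
rewrite (big_pred1 io) => [|m]; last first.
  by apply/eqP/eqP => [mE|->]; [apply: val_inj; rewrite /= iE; lia | rewrite iE iE' ii'].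
rewrite big1 => [|p /eqP pi]; last first.
  have iA := ltn_ord i'; rewrite vs // ps.2 /=; apply/andP; split.
    apply: contraTneq iA => pE; move: pi; rewrite pE /= => /(congr1 val) /= AE.
    by rewrite -leqNgt -iE' -AE.
  by rewrite pi iE' ltnn eqxx /= -ltnNge ltn_ord.
lra.
Qed.

Lemma volume_w0 (i : 'I_A) (io : 'I_A.+1) : io = i :> nat -> i.+1 = A ->
  volume_at 0 0 i io.
Proof.
move=> iE iA s v ps vg vs; have es := wo_pending ps.
rewrite (vol_rem _ es).
apply: (@integral_if0 _ _ (fun x => 0 <= x <= v (ch io))
  (fun x => (last_stage K (v (inr pmax)))%:E)) => [x|ok hE].
  rewrite (@volume_last K) //; first last.
  - exact: (resting_rem x ps es vs).
  - exact: on_graph_step.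
  - have [us sE] := pending_w ps; split => // e; rewrite sE iA.
    by case fe: (is_free e); rewrite //= settled_last.
  have := feasible_w x iE (vs _ es); rewrite iA feasible_last => ->.
  by rewrite !ffunE /= mulr0 addr0.
by apply: integral_stage_w0 hE; exact: chain_ge0_w ps vg vs ok.
Qed.

Lemma volume_w n (i i' : 'I_A) (io io' : 'I_A.+1) : io = i :> nat ->
  io' = i' :> nat -> i' = i.+1 :> nat ->
  volume_at n K.+1 i' io' -> volume_at n.+1 0 i io.
Proof.
move=> iE iE' ii' IH s v ps vg vs; have es := wo_pending ps.
rewrite (vol_rem _ es).
apply: (@integral_if0 _ _ (fun x => 0 <= x <= v (ch io))
  (fun x => (stage K y n K.+1 (v (ch io) - x + y) (v (inr pmax)))%:E)) => [x|ok hE].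
  have ps' : pending i' K.+1 (rem (wo i) s) by rewrite ii'; exact: pending_w.
  have vg' : on_graph is_free beta base_flow (axpy v x (vec (wo i))) by exact: on_graph_step.
  have vs' := resting_rem x ps es vs.
  rewrite IH // (chain_next iE iE' ii' ps' vg' vs') {1}ii' (feasible_w x iE (vs _ es)).
  by rewrite !ffunE /= iE leqnn mulr0 addr0 mulrN mulr1.
by apply: integral_stage_w hE; exact: chain_ge0_w ps vg vs ok.
Qed.

(** The outer induction goes backwards from the last vertex with a separate sink edge, the inner one
    over the source edges into the current vertex. *)
Lemma volume_stage n (i : 'I_A) (io : 'I_A.+1) j : io = i :> nat ->
  (i + n.+1)%N = A -> (j <= K.+1)%N -> volume_at n j i io.
Proof.
elim: n i io j => [|n IHn] i io j iE inA.
  elim: j => [|j IH] jK; last by apply: volume_z => //; exact/IH/ltnW.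
  by apply: volume_w0 => //; rewrite -[RHS]inA addn1.
elim: j => [|j IH] jK; last by apply: volume_z => //; exact/IH/ltnW.
have iA : (i.+1 < A)%N by rewrite -[ltnRHS]inA; lia.
have iA' : (i.+1 < A.+1)%N by exact: ltnW.
apply: (@volume_w n i (Ordinal iA) io (Ordinal iA')) => //.
by apply: IHn => //=; rewrite -[RHS]inA; lia.
Qed.

Lemma card_free : #|is_free| = (K.+1 * A.+1 - 1 + A)%N.
Proof.
rewrite -sum1_card !big_sumType /= big_pred0 // add0n addnC; congr (_ + _)%N.
  rewrite (eq_bigl (mem (predC1 pmax))) // sum1_card.
  by have := cardC1 pmax; rewrite card_prod !card_ord subn1.
by rewrite (eq_bigl predT) // sum1_card card_ord.
Qed.

(** Starts the integration for every [a]: in stage [(0, K.+1)] nothing is settled, and the base flow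
    is a feasible point with all pending coordinates 0. The dimension is [(ka - 1) + (a - 1)]. *)
Lemma normalized_volume_mcar val :
  (forall s, pending 0 K.+1 s -> on_graph is_free beta base_flow base_flow ->
     resting s base_flow -> feasible 0 K.+1 base_flow -> vol s base_flow = val%:E) ->
  normalized_volume mcar_polytope = ((K.+1 * A.+1 - 1 + A)`!%:R * val)%:E.
Proof.
move=> valE; have [f0 f0g f0pos] := exists_positive_flow.
have frame := graph_polytope_frame beta_free base_flow_free f0g f0pos.
rewrite (normalized_volume_frame polytope_measurable frame) EFinM -card_free; congr (_ * _)%E.
pose s := [seq enum_val i | i <- enum 'I_#|is_free|].
rewrite (map_comp (fun e => vec e) (@enum_val _ is_free)) -/s.
have sp : uniq s /\ s =i is_free.
  split; first by rewrite map_inj_uniq ?enum_uniq //; exact: enum_val_inj.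
  move=> e; apply/mapP/idP => [[i _ ->]|fe]; first exact: enum_valP.
  by exists (enum_rank_in fe e); rewrite ?mem_enum // enum_rankK_in.
have vs : resting s base_flow.
  by move=> e es; apply: base_flow_free; rewrite -[is_free e]sp.2.
have vg : on_graph is_free beta base_flow base_flow.
  by apply: on_graph_v0; exact: base_flow_free.
have rE : base_flow (inr pmax) = X by rewrite ffunE /= eqxx mul1r.
have ps : pending 0 K.+1 s.
  split=> [|e]; first exact: sp.1.
  rewrite sp.2 -[e \in is_free]/(is_free e) [settled _ _ _](_ : _ = false) ?andbT //.
  by case: e => [[l|m]|p] //=; rewrite [(K < _)%N]ltnNge -ltnS ltn_ord andbF.
have ok : feasible 0 K.+1 base_flow.
  apply/feasibleP => e /orP[|/eqP ->]; last by rewrite rE ltW.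
  by case: e => [[l|m]|p] //=; rewrite [(K < _)%N]ltnNge -ltnS ltn_ord andbF.
exact: valE.
Qed.

Lemma normalized_volume_mcar0 : A = 0%N ->
  normalized_volume mcar_polytope = ((K.+1 * A.+1 - 1 + A)`!%:R * last_stage K X)%:E.
Proof.
move=> A0; apply: normalized_volume_mcar => s ps vg vs ok.
(* [A] occurs in the types of the edges, so the equation [A = 0] is transported through a separate
   index [i]. *)
have psA i : i = 0%N -> pending i K.+1 s by move=> ->.
have okA i : i = 0%N -> feasible i K.+1 base_flow by move=> ->.
rewrite (@volume_last K) // ?feasible_last ?okA //.
  by rewrite ffunE /= eqxx mul1r.
have [us sE] := psA _ A0; split => // e; rewrite sE.
by case fe: (is_free e); rewrite //= settled_last.
Qed.

Lemma normalized_volume_mcarS n : A = n.+1 ->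
  normalized_volume mcar_polytope =
  ((K.+1 * A.+1 - 1 + A)`!%:R * stage K y n K.+1 y X)%:E.
Proof.
move=> AE; apply: normalized_volume_mcar => s ps vg vs ok.
have A0 : (0 < A)%N by rewrite AE.
rewrite (@volume_stage n (Ordinal A0) ord0 K.+1) // ok !ffunE /= eqxx mul1r.
by rewrite leqNgt A0 mul0r addr0 mul1r.
Qed.

End caracol.

(** * The flow polytope of the graph and the closed formula *)

(** The equation at vertex 0 fixes the total source flow, and the one at vertex [l + 1] is the
    conservation law with chain index [l]; the sums over edges split by the three kinds of edges. *)
Lemma flow_polytope_conserves (R : realType) (K A : nat) (x y : R)
    (f : {ffun edge (MCar K.+1 A.+1) -> R}) :
  flow_polytope (@MCar_netflow R K.+1 A.+1 x y) f <->
  (forall e, 0 <= f e) /\ conserves (K.+1%:R * x) y f.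
Proof.
have sumE (Q : pred (edge (MCar K.+1 A.+1))) : \sum_(e | Q e) f e =
    \sum_(l | Q (inl (inl l))) f (inl (inl l)) +
    \sum_(i | Q (inl (inr i))) f (inl (inr i)) + \sum_(p | Q (inr p)) f (inr p).
  by rewrite !big_sumType.
have ioE (m n : nat) : (m < A.+3)%N -> (n < A.+3)%N ->
    (inord m == inord n :> 'I_A.+3) = (m == n).
  by move=> mA nA; rewrite -val_eqE /= !inordK.
have io0 (m : nat) : (m.+1 < A.+3)%N -> (inord m.+1 == ord0 :> 'I_A.+3) = false.
  by move=> mA; rewrite -val_eqE /= inordK.
have at0 : \sum_(e | source e == ord0) f e - \sum_(e | target e == ord0) f e =
    \sum_p f (inr p).
  rewrite !sumE.
  rewrite [X in X + _ + _ - _]big_pred0 => [|l]; last first.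
    by have lA := ltn_ord l; rewrite /= io0 //; lia.
  rewrite [X in _ + X + _ - _]big_pred0 => [|i]; last first.
    by case: i => i iA; rewrite /= in iA *; rewrite io0 //; lia.
  rewrite [X in _ - (X + _ + _)]big_pred0 => [|l]; last first.
    by have lA := ltn_ord l; rewrite /= io0 //; lia.
  rewrite [X in _ - (_ + X + _)]big_pred0 => [|i]; last by rewrite /= -val_eqE.
  rewrite [X in _ - (_ + _ + X)]big_pred0 => [|[p1 p2]]; last first.
    by have pA := ltn_ord p2; rewrite /= io0 //; lia.
  by rewrite !addr0 subr0 add0r.
have atS (l : 'I_A.+1) : \sum_(e | source e == inord l.+1) f e -
      \sum_(e | target e == inord l.+1) f e =
    f (inl (inl l)) + \sum_(i : 'I_A | i == l :> nat) f (inl (inr i)) -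
    (\sum_(m : 'I_A.+1 | m.+1 == l) f (inl (inl m)) +
     \sum_(p : 'I_K.+1 * 'I_A.+1 | p.2 == l) f (inr p)).
  have lA := ltn_ord l; rewrite !sumE; congr (_ - _).
    rewrite (big_pred1 l) => [|m]; last first.
      have mA := ltn_ord m.
      by rewrite /= ioE ?eqSS //; lia.
    rewrite [X in _ + X]big_pred0 => [|p]; last first.
      by rewrite /= eq_sym io0 //; lia.
    rewrite addr0; congr (_ + _); apply: eq_bigl => i.
    by case: i => i iA; rewrite /= in iA *; rewrite ioE ?eqSS //; lia.
  rewrite [X in _ + X + _]big_pred0 => [|i]; last first.
    by rewrite /= -val_eqE /= inordK; lia.
  rewrite addr0; congr (_ + _); apply: eq_bigl.
    by move=> m; have mA := ltn_ord m; rewrite /= ioE ?eqSS //; lia.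
  move=> [p1 p2]; have pA := ltn_ord p2.
  by rewrite /= ioE ?eqSS //; lia.
have lmax (l : 'I_A.+1) : (inord l.+1 == ord_max :> 'I_A.+3) = false.
  by have lA := ltn_ord l; rewrite -val_eqE /= inordK; lia.
split=> -[fpos H]; split=> //.
- split=> [|l].
    by rewrite -at0 H // -val_eqE.
  rewrite -atS H ?lmax // /MCar_netflow lmax io0 //.
  by have lA := ltn_ord l; lia.
- case: H => HX Hl j jmax; have [->|j0] := eqVneq j ord0.
    by rewrite at0 HX.
  have jA := ltn_ord j.
  have jA' : (j.-1 < A.+1)%N.
    move: jmax j0; rewrite -!val_eqE /=; lia.
  have jE : j = inord (Ordinal jA').+1.
    by apply: val_inj; move: j0; rewrite -val_eqE /= inordK; lia.
  by rewrite /MCar_netflow (negbTE j0) (negbTE jmax) jE atS Hl.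
Qed.

Lemma flow_polytope_graph (R : realType) (K A : nat) (x y : R) :
  @flow_polytope R A.+2 (MCar K.+1 A.+1) (@MCar_netflow R K.+1 A.+1 x y) =
  graph_polytope (@is_free K A) (@beta K A) (base_flow K A (K.+1%:R * x) y).
Proof.
apply/seteqP; split => f.
  move/flow_polytope_conserves => [fpos cf]; split => //.
  exact/on_graph_solved/solved_conserves.
move=> [fpos fg]; apply/flow_polytope_conserves; split => //.
exact: on_graph_conserves fg.
Qed.

(** With [a = n + 2] and [q = ka - 1], the identity [(q+1)! = k a q!] turns the bracket of the stage
    into [X^q (X + a y) / (a q!)]. *)
Lemma stage_Cat (R : realType) (K n : nat) (X y : R) :
  (K.+1 * n.+2 - 1 + n.+1)`!%:R * stage K y n K.+1 y X =
  Cat R n.+2 (K.+1 * n.+2 - 1) * X ^+ (K.+1 * n.+2 - 1) * (X + n.+2%:R * y) ^+ n.+1.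
Proof.
have fact0 q : (q`!%:R : R) != 0 by rewrite pnatr_eq0 -lt0n fact_gt0.
rewrite /stage /Cat (_ : (K.+1 * n + K + K.+1 = K.+1 * n.+2 - 1)%N); last by lia.
have : ((K.+1 * n.+2 - 1).+1 = K.+1 * n.+2)%N by lia.
move: (K.+1 * n.+2 - 1)%N => q qE.
have qf : q.+1`!%:R = K.+1%:R * n.+2%:R * q`!%:R :> R.
  by rewrite factS natrM qE natrM.
(* That is, [Cat(a, q) = (a + q - 1)! / (a! q!)]. *)
have -> : ('C(n.+2 + q, n.+2)%:R / (n.+2 + q)%:R : R) =
    (q + n.+1)`!%:R / (n.+2`!%:R * q`!%:R).
  have := bin_fact (leq_addr q n.+2); rewrite addKn.
  have -> : ((n.+2 + q)`! = (n.+2 + q) * (q + n.+1)`!)%N.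
    by rewrite (_ : n.+2 + q = (q + n.+1).+1)%N ?factS //; lia.
  move=> /(congr1 (fun m => m%:R : R)); rewrite !natrM => binE.
  apply/eqP; rewrite eqr_div ?mulf_neq0 ?fact0 ?pnatr_eq0 //.
  by rewrite binE mulrC.
rewrite qf exprS (_ : y + n.+1%:R * y + X = X + n.+2%:R * y); last first.
  by rewrite -(natr1 n.+1); ring.
have -> : n.+2`!%:R = n.+2%:R * n.+1`!%:R :> R by rewrite factS natrM.
rewrite [in RHS]exprS.
have := fact0 q; have := fact0 n.+1; have : K.+1%:R != 0 :> R by [].
have : n.+2%:R != 0 :> R by [].
move: (n.+2%:R) => n2.
move: (K.+1%:R) (q`!%:R) (n.+1`!%:R) (X ^+ q) ((q + n.+1)`!%:R) => k1 F G u w.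
move: ((X + n2 * y) ^+ n) => t.
by move=> n20 k10 G0 F0; field; rewrite ?n20 ?k10 ?G0 ?F0.
Qed.

Theorem theorem5p6 (R : realType) (k a : nat) (x y : R)
    (hk : (1 <= k)%N) (ha : (1 <= a)%N) (hx : 0 < x) (hy : 0 <= y) :
  normalized_volume (@flow_polytope R a.+1 (MCar k a) (@MCar_netflow R k a x y))
  = (Cat R a (k * a - 1) * (k%:R * x) ^+ (k * a - 1)
     * (k%:R * x + a%:R * y) ^+ (a - 1))%:E.
Proof.
case: k hk => // K _; case: a ha => // A _; rewrite flow_polytope_graph.
have X0 : 0 < K.+1%:R * x by rewrite mulr_gt0 // ltr0n.
(* For [a = 1] there is no separate sink edge, hence no [stage]; the volume is the last stage alone,
   and [Cat(1, k - 1) = 1]. *)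
case: A => [|n]; last first.
  by rewrite (normalized_volume_mcarS K X0 hy (erefl _)) stage_Cat [in RHS]subn1.
rewrite (normalized_volume_mcar0 K X0 hy (erefl _)) subnn expr0 mulr1 muln1 subn1 addn0 /=.
congr (_%:E); rewrite /last_stage /Cat add1n bin1 divff ?mul1r ?pnatr_eq0 //.
by rewrite mulrC divfK // pnatr_eq0 -lt0n fact_gt0.
Qed.
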